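(* Let $X$ be a real reflexive Banach space and let $f_1,f_2\colon X\to\mathbb{R}$ be continuous convex functions. If the quotient $f_1/f_2$ is defined on $X$ (i.e. $f_2(x)\neq 0$ for every $x\in X$), then $f_1/f_2$ is d.c. on $X$.
   Context: A real function on a convex subset $C$ of a real normed linear space is called d.c. (delta-convex) if it is the difference of two continuous convex functions on $C$. *)

(* Defs.v *)
From HB Require Import structures.
From mathcomp Require Import all_boot all_order all_algebra.
From mathcomp Require Import interval_inference.
From mathcomp Require Import all_classical all_reals.
From mathcomp Require Import topology normedtype convex.

Set Implicit Arguments.
Unset Strict Implicit.
Unset Printing Implicit Defensive.

Import Order.TTheory GRing.Theory Num.Theory.
Import numFieldNormedType.Exports.

Local Open Scope classical_set_scope.
Local Open Scope ring_scope.

(* The topological dual of a real normed space, as a normed module under the  *)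
(* operator norm, so that it can be iterated to form the bidual.              *)
Section dual_predicate.
Context (R : realType) (X : normedModType R).

Definition dual_pred : {pred X -> R^o} :=
  [pred f | `[< linear f /\ continuous f >]].

Lemma dual_pred_submod_closed : submod_closed dual_pred.
Proof.
split.
  by apply/asboolP; split=> [a x y|x]; [rewrite /= scaler0 addr0|exact: cvg_cst].
move=> a f g /asboolP[lf cf] /asboolP[lg cg]; apply/asboolP; split.
  move=> b x y; rewrite -[LHS]/(a *: f (b *: x + y) + g (b *: x + y)).
  rewrite -[RHS]/(b *: (a *: f x + g x) + (a *: f y + g y)).
  rewrite lf lg !scalerDr !scalerA (mulrC b a) -!addrA; congr (_ + _).
  by rewrite addrCA.
move=> x; rewrite -[a *: f + g]/(fun y => a *: f y + g y).
by apply: cvgD; [apply: cvgZl_tmp; exact: cf|exact: cg].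
Qed.

HB.instance Definition _ :=
  GRing.isSubmodClosed.Build R (X -> R^o) dual_pred dual_pred_submod_closed.

End dual_predicate.

Record dual (R : realType) (X : normedModType R) : Type := Dual {
  dual_fun :> X -> R^o;
  dual_funP : dual_fun \in @dual_pred R X }.

Section dual_theory.
Context (R : realType) (X : normedModType R).
Implicit Types f g : dual X.

HB.instance Definition _ := [isSub for @dual_fun R X].
HB.instance Definition _ := [Choice of dual X by <:].
HB.instance Definition _ := [SubChoice_isSubLmodule of dual X by <:].

Lemma dual_linear f : linear f.
Proof. by case: f => f /= /asboolP[]. Qed.

Lemma dual_continuous f : continuous f.
Proof. by case: f => f /= /asboolP[]. Qed.

HB.instance Definition _ f :=
  GRing.isLinear.Build R X R^o *:%R (dual_fun f) (@dual_linear f).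

Lemma dualD f g x : (f + g) x = f x + g x. Proof. by []. Qed.

Lemma dualZ (a : R) f x : (a *: f) x = a * f x. Proof. by []. Qed.

Lemma dual_ext f g : (forall x, f x = g x) -> f = g.
Proof. by move=> fg; apply/val_inj/funext. Qed.

Definition dual_norm f : R := sup [set `|f x| | x in [set x | `|x| <= 1]].

Lemma dual_norm_has_sup f :
  has_sup [set `|f x| | x in [set x | `|x| <= 1]].
Proof.
split; first by exists `|f 0|, 0 => //=; rewrite normr0.
have /linear_boundedP/pinfty_ex_gt0[M M0 fM] :
    bounded_near f (nbhs (0 : X)).
  by apply: continuous_linear_bounded; exact: dual_continuous.
exists M => _ [x /= x1 <-]; apply: (le_trans (fM x)).
by rewrite ler_piMr// ltW.
Qed.

Lemma dual_norm_ge0 f : 0 <= dual_norm f.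
Proof.
apply: ub_le_sup; first exact: (dual_norm_has_sup f).2.
by exists 0; rewrite /= ?normr0// linear0 normr0.
Qed.

Lemma ler_dual_norm f x : `|f x| <= dual_norm f * `|x|.
Proof.
have [->|x0] := eqVneq x 0; first by rewrite linear0 !normr0 mulr0.
have nx : 0 < `|x| by rewrite normr_gt0.
rewrite -ler_pdivrMr// mulrC -[X in X * _]ger0_norm ?invr_ge0//.
rewrite -normrM -[_ * f x]/(_ *: f x) -linearZ.
apply: ub_le_sup; first exact: (dual_norm_has_sup f).2.
exists (`|x|^-1 *: x) => //=.
by rewrite normrZ ger0_norm ?invr_ge0// mulVf// gt_eqF.
Qed.

Lemma dual_norm_le f M : (forall x, `|x| <= 1 -> `|f x| <= M) ->
  dual_norm f <= M.
Proof.
move=> fM; apply: ge_sup; first exact: (dual_norm_has_sup f).1.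
by move=> _ [x /= x1 <-]; exact: fM.
Qed.

Let dual_norm_D f g : dual_norm (f + g) <= dual_norm f + dual_norm g.
Proof.
apply: dual_norm_le => x x1; rewrite dualD (le_trans (ler_normD _ _))//.
by apply: lerD; apply: (le_trans (ler_dual_norm _ _));
  rewrite ler_piMr// dual_norm_ge0.
Qed.

Let dual_norm_eq0 f : dual_norm f = 0 -> f = 0.
Proof.
move=> f0; apply: dual_ext => x; apply/normr0_eq0/le_anti.
by rewrite normr_ge0 andbT; have := ler_dual_norm f x; rewrite f0 mul0r.
Qed.

Let dual_norm_leZ (a : R) f : dual_norm (a *: f) <= `|a| * dual_norm f.
Proof.
apply: dual_norm_le => x x1; rewrite dualZ normrM ler_wpM2l//.
by apply: (le_trans (ler_dual_norm _ _)); rewrite ler_piMr// dual_norm_ge0.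
Qed.

Let dual_normZ (a : R) f : dual_norm (a *: f) = `|a| * dual_norm f.
Proof.
apply/le_anti; rewrite dual_norm_leZ/=.
have [->|a0] := eqVneq a 0; first by rewrite normr0 mul0r dual_norm_ge0.
rewrite -ler_pdivlMl ?normr_gt0// -normfV.
by rewrite -{1}[f](scalerK a0) dual_norm_leZ.
Qed.

HB.instance Definition _ := @Lmodule_isNormed.Build R (dual X) dual_norm
  dual_norm_D dual_normZ dual_norm_eq0.

Lemma dual_normE f : `|f| = dual_norm f. Proof. by []. Qed.

End dual_theory.

Section reflexive.
Context (R : realType) (X : normedModType R).

Lemma dual_eval_subproof (x : X) :
  (fun f : dual X => f x) \in @dual_pred R (dual X).
Proof.
apply/asboolP.
have ll : linear ((fun f : dual X => f x) : dual X -> R^o) by [].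
split=> //.
pose l := GRing.isLinear.Build R (dual X) R^o *:%R _ ll.
pose L : {linear dual X -> R^o} := HB.pack (fun f : dual X => f x : R^o) l.
apply: (@bounded_linear_continuous _ _ _ L); apply/linear_boundedP.
near=> r => f; rewrite mulrC; apply: (le_trans (ler_dual_norm f x)).
by rewrite ler_wpM2l// ?dual_norm_ge0//; near: r; exact: nbhs_pinfty_ge.
Unshelve. all: by end_near. Qed.

Definition dual_eval (x : X) : dual (dual X) := Dual (dual_eval_subproof x).

Definition reflexive_space : Prop :=
  forall F : dual (dual X), exists x : X, dual_eval x = F.

End reflexive.
Arguments reflexive_space {R} X.

(* Only the values of f, g and h on C matter; C is meant to be convex.        *)
Definition delta_convex (R : realType) (X : normedModType R) (C : set X)
    (f : X -> R) : Prop :=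
  exists g h : X -> R,
    [/\ {within C, continuous g}, convex_function C g,
        {within C, continuous h}, convex_function C h &
        forall x, C x -> f x = g x - h x].

(* Main.v *)
Require Import Defs.
From HB Require Import structures.
From mathcomp Require Import all_boot all_order all_algebra.
From mathcomp Require Import interval_inference.
From mathcomp Require Import all_classical all_reals.
From mathcomp Require Import topology normedtype convex.
From mathcomp Require Import ring lra.

Set Implicit Arguments.
Unset Strict Implicit.
Unset Printing Implicit Defensive.

Import Order.TTheory GRing.Theory Num.Theory.
Import numFieldNormedType.Exports.

Local Open Scope classical_set_scope.
Local Open Scope ring_scope.

(** A convex function that vanishes nowhere has a constant sign.  If [f2 < 0],
    it is convex and bounded above, hence constant.  If [f2 > 0], reflexivity
    bounds [f2] away from [0] on every ball: otherwise pick a bounded sequence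
    along which [f2] tends to [0]; its limit along an ultrafilter is an element
    of the bidual, hence a point [x], and a subgradient of [f2] at [x] gives
    [f2 x <= 0].  So there is a convex nondecreasing [k] with
    [1 / f2 x ^ 2 <= k `|x|], and then [1 / f2 + (f2 + k `|.|) ^ 2 / 2] is
    convex, which makes [1 / f2] d.c.; products of d.c. functions are d.c.

    Subgradients come from Zorn's lemma: a minimal convex function that
    vanishes at [0] and lies below a given one is linear. *)

(** * Calculus of convex functions on a real vector space *)

Section convexity.
Context {R : realType} {V : lmodType R}.
Implicit Types (f g h : V -> R) (x y : V).

(** Two free weights of sum 1 replace the bundled parameter of [convex_function], so side conditions
    are plain inequalities. *)
Definition convex f := forall (a b : R) x y,
  0 <= a -> 0 <= b -> a + b = 1 -> f (a *: x + b *: y) <= a * f x + b * f y.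

Lemma convex_functionTP f : convex_function [set: V] f <-> convex f.
Proof.
split=> [cf a b x y a0 b0 ab|cf t x y _ _].
  have a1 : a <= 1 by rewrite -ab lerDl.
  have -> : b = 1 - a by rewrite -ab addrC addKr.
  exact: (cf (Itv01 a0 a1) x y (in_setT _) (in_setT _)).
by apply: cf; rewrite ?subr_ge0 ?subrKC// /onem subrKC.
Qed.

Lemma convexD f g : convex f -> convex g -> convex (fun x => f x + g x).
Proof.
move=> cf cg a b x y a0 b0 ab.
by rewrite !mulrDr addrACA lerD ?cf ?cg.
Qed.

Lemma convexZ c f : 0 <= c -> convex f -> convex (fun x => c * f x).
Proof.
move=> c0 cf a b x y a0 b0 ab.
by rewrite !(mulrCA _ c) -mulrDr ler_wpM2l ?cf.
Qed.

Lemma convex_cst c : convex (fun=> c).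
Proof. by move=> a b x y _ _ ab; rewrite -mulrDl ab mul1r. Qed.

Lemma convex_sum (I : Type) (r : seq I) (F : I -> V -> R) :
  (forall i, convex (F i)) -> convex (fun x => \sum_(i <- r) F i x).
Proof.
move=> cF; elim: r => [|i r IH] a b x y a0 b0 ab.
  by rewrite !big_nil !mulr0 addr0.
by rewrite !big_cons; exact: (convexD (cF i) IH).
Qed.

Lemma convex_max f g : convex f -> convex g -> convex (fun x => Num.max (f x) (g x)).
Proof.
move=> cf cg a b x y a0 b0 ab; rewrite ge_max; apply/andP; split.
  apply: (le_trans (cf _ _ _ _ a0 b0 ab)).
  by rewrite lerD// ler_wpM2l// le_max lexx.
apply: (le_trans (cg _ _ _ _ a0 b0 ab)).
by rewrite lerD// ler_wpM2l// le_max lexx orbT.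
Qed.

Lemma convex_oppx f : convex f -> convex (fun x => f (- x)).
Proof.
move=> cf a b x y a0 b0 ab.
by rewrite opprD -!scalerN cf.
Qed.

Lemma sqr_convex_comb (a b u v : R) : 0 <= a -> 0 <= b -> a + b = 1 ->
  (a * u + b * v) ^+ 2 <= a * u ^+ 2 + b * v ^+ 2.
Proof.
move=> a0 b0 ab; rewrite -subr_ge0.
have -> : b = 1 - a by lra.
rewrite (_ : _ - _ = a * (1 - a) * (u - v) ^+ 2); last by ring.
by rewrite mulr_ge0 ?sqr_ge0 // mulr_ge0 //; lra.
Qed.

Lemma convex_sqr f : (forall x, 0 <= f x) -> convex f ->
  convex (fun x => f x ^+ 2).
Proof.
move=> f0 cf a b x y a0 b0 ab.
apply: le_trans (sqr_convex_comb _ _ a0 b0 ab).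
by rewrite lerXn2r ?nnegrE ?cf// addr_ge0// mulr_ge0.
Qed.

(** If [f y < f x], convexity makes [f] grow at least linearly beyond [x] on the ray from [y]. The
    chosen [t] would force [f z >= M + (f x - f y) > M]. *)
Lemma convex_bounded_above_cst f M : convex f -> (forall x, f x <= M) ->
  forall x y, f x = f y.
Proof.
move=> cf fM; suff H x y : f x <= f y by move=> x y; apply/le_anti; rewrite !H.
rewrite leNgt; apply/negP => fyx.
(* The point [x] lies on the segment from [y] to [z], at parameter [1 / t]. *)
pose t := (M - f y) / (f x - f y) + 1.
have fM0 : 0 <= (M - f y) / (f x - f y).
  by rewrite divr_ge0// subr_ge0 ?fM// ltW.
have t0 : 0 < t by rewrite /t ltr_pwDr.
have t1 : t^-1 <= 1 by rewrite invf_le1// lerDr.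
pose z := y + t *: (x - y).
have xE : x = t^-1 *: z + (1 - t^-1) *: y.
  rewrite /z scalerDr scalerA mulVf ?gt_eqF// scale1r scalerBl scale1r.
  by rewrite [RHS]addrC addrA subrK addrC subrK.
have := cf t^-1 (1 - t^-1) z y; rewrite -xE invr_ge0 subr_ge0.
move=> /(_ (ltW t0) t1); rewrite addrCA subrr addr0 => /(_ erefl).
have -> : t^-1 * f z + (1 - t^-1) * f y = f y + t^-1 * (f z - f y) by ring.
rewrite -lerBlDl mulrC ler_pdivlMr// mulrDr mulr1 mulrCA divff ?mulr1; last first.
  by rewrite subr_eq0 gt_eqF.
by have := fM z; lra.
Qed.

End convexity.

(** Used to show that pointwise infima are convex: the lower bound passes to the infima one set at a
    time. *)
Lemma le_conv_inf {R : realType} (a b s : R) (U W : set R) :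
  0 <= a -> 0 <= b -> U !=set0 -> W !=set0 ->
  (forall u w, U u -> W w -> s <= a * u + b * w) -> s <= a * inf U + b * inf W.
Proof.
have le_mul_inf (c q : R) (A : set R) : 0 <= c -> A !=set0 ->
    (forall u, A u -> q <= c * u) -> q <= c * inf A.
  rewrite le0r => /predU1P[->|c0] [u0 Au0] qA.
    by rewrite mul0r -(mul0r u0) qA.
  rewrite -ler_pdivrMl//; apply: lb_le_inf; first by exists u0.
  by move=> u Au; rewrite ler_pdivrMl// qA.
move=> a0 b0 U0 W0 sUW.
rewrite -lerBlDr; apply: (le_mul_inf) => // u Uu; rewrite lerBlDr addrC.
by rewrite -lerBlDr; apply: (le_mul_inf) => // w Ww; rewrite lerBlDl sUW.
Qed.

(** * Linear minorants of convex functions by Zorn's lemma *)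

Section hahn_banach.
Context {R : realType} {V : lmodType R}.
Implicit Types (f g h : V -> R) (x y : V).

(** The midpoint of [x] and [- x] is 0. For a minorant of [h] this yields the lower bound
    [- h (- x)] at [x], so chains have finite infima. *)
Let cvx0_opp g x : convex g -> g 0 = 0 -> - g (- x) <= g x.
Proof.
move=> cg g0; have := cg 2^-1 2^-1 x (- x).
rewrite scalerN subrr g0 => /(_ _ _ _)/[!invr_ge0]; lra.
Qed.

Lemma minimal_convex h : convex h -> h 0 = 0 ->
  exists g, [/\ convex g, g 0 = 0, forall x, g x <= h x &
    forall g', convex g' -> g' 0 = 0 -> (forall x, g' x <= g x) ->
      forall x, g x <= g' x].
Proof.
move=> ch h0.
pose P g := [/\ convex g, g 0 = 0 & forall x, g x <= h x].
pose T := {g | P g}.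
pose le_rev (g1 g2 : T) := `[< forall x, sval g2 x <= sval g1 x >].
have := @Zorn T le_rev.
case.
- by move=> t; apply/asboolP.
- move=> r s t /asboolP rs /asboolP st; apply/asboolP => x.
  exact: le_trans (st x) (rs x).
- move=> [s Ps] [t Pt] /asboolP /= st /asboolP /= ts.
  apply: eq_exist; apply/funext => x; apply/le_anti.
  by rewrite ts st.
(* The empty chain is bounded by [h] itself, a nonempty one by its pointwise infimum. *)
- move=> A totA; have [[q0 Aq0]|A0] := pselect (A !=set0); last first.
    have Ph : P h by [].
    by exists (exist _ h Ph) => s As; case: A0; exists s.
  pose S x := [set sval q x | q in A].
  have SN0 x : S x !=set0 by exists (sval q0 x), q0.
  have Slb x : has_lbound (S x).
    exists (- h (- x)) => _ [q _ <-]; have [cq q00 qh] := svalP q.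
    by apply: le_trans (cvx0_opp x cq q00); rewrite lerN2.
  have infS q x : A q -> inf (S x) <= sval q x.
    by move=> Aq; apply: ge_inf => //; exists q.
  have Pinf : P (fun x => inf (S x)).
    split.
    + move=> a b x y a0 b0 ab; apply: le_conv_inf => // _ _ [q1 Aq1 <-] [q2 Aq2 <-].
      have [q [Aq q1q q2q]] : exists q, [/\ A q, le_rev q1 q & le_rev q2 q].
        by have [? | ?] := totA _ _ Aq1 Aq2; [exists q2|exists q1]; split => //;
          apply/asboolP.
      move/asboolP in q1q; move/asboolP in q2q.
      apply: (le_trans (infS q _ Aq)); have [cq _ _] := svalP q.
      by apply: (le_trans (cq _ _ _ _ a0 b0 ab)); rewrite lerD ?ler_wpM2l.
    + rewrite (_ : S 0 = [set 0]) ?inf1//; apply/seteqP; split=> [_ [q _ <-]|_ ->].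
        by have [] := svalP q.
      by exists q0 => //; have [] := svalP q0.
    + by move=> x; apply: (le_trans (infS _ x Aq0)); have [] := svalP q0.
  by exists (exist _ _ Pinf) => s As; apply/asboolP => x; exact: infS.
move=> [g [cg g0 gh]] gmax; exists g; split => // g' cg' g'0 g'g x.
have Pg' : P g' by split=> // y; exact: le_trans (g'g y) (gh y).
have := gmax (exist _ g' Pg'); rewrite /le_rev /=.
by move=> /(_ (asboolT g'g)) [->].
Qed.

(** For [0 < t <= 1] the rescaling [t^-1 * g (t *: y)] is again convex, zero at 0 and below [g], so
    minimality gives equality. The case [t > 1] follows by applying this to [t^-1]. *)
Lemma minimal_convex_pos_homogeneous g : convex g -> g 0 = 0 ->
    (forall g', convex g' -> g' 0 = 0 -> (forall x, g' x <= g x) ->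
      forall x, g x <= g' x) ->
  forall (t : R) x, 0 < t -> g (t *: x) = t * g x.
Proof.
move=> cg g0 gmin.
have H (t : R) x : 0 < t -> t <= 1 -> g (t *: x) = t * g x.
  move=> t0 t1.
  have le1 y : g (t *: y) <= t * g y.
    have := cg t (1 - t) y 0; rewrite scaler0 addr0 g0 mulr0 addr0.
    by apply; rewrite ?(ltW t0)// ?subr_ge0// subrKC.
  apply/le_anti; rewrite le1 /= -ler_pdivlMl//.
  apply: (gmin (fun y => t^-1 * g (t *: y))) => [||y].
  - apply: convexZ; first by rewrite invr_ge0 ltW.
    by move=> a b y z a0 b0 ab; rewrite scalerDr !scalerA ![t * _]mulrC -!scalerA cg.
  - by rewrite scaler0 g0 mulr0.
  - by rewrite ler_pdivrMl.
move=> t x t0; have [t1|t1] := leP t 1; first exact: H.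
have xE : x = t^-1 *: (t *: x) by rewrite scalerK ?gt_eqF.
rewrite [in RHS]xE [in RHS]H ?invr_gt0//.
  by rewrite mulVKf ?gt_eqF.
by rewrite invf_le1// ltW.
Qed.

(* Translating along [y] and optimising over [t] gives a convex minorant of
   [g]; minimality forces it to be [g] itself, which is superadditivity. *)
Lemma minimal_convex_linear g : convex g -> g 0 = 0 ->
    (forall g', convex g' -> g' 0 = 0 -> (forall x, g' x <= g x) ->
      forall x, g x <= g' x) ->
  linear (g : V -> R^o).
Proof.
move=> cg g0 gmin.
have hom := minimal_convex_pos_homogeneous cg g0 gmin.
have hom0 (t : R) x : 0 <= t -> g (t *: x) = t * g x.
  by rewrite le0r => /predU1P[->|/hom//]; rewrite scale0r mul0r.
have subadd x y : g (x + y) <= g x + g y.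
  have := cg 2^-1 2^-1 (2 *: x) (2 *: y).
  by rewrite !scalerA mulVf// !scale1r !hom//; lra.
have superadd x y : g x + g y <= g (x + y).
  pose S z := [set g (z + t *: y) - t * g y | t in [set t | 0 <= t]].
  have S0 z : S z !=set0 by exists (g (z + 0 *: y) - 0 * g y), 0 => /=.
  have Slb z : has_lbound (S z).
    exists (- g (- z)) => _ [t /= t0 <-].
    have := subadd (z + t *: y) (- z); rewrite addrC addKr hom0//; lra.
  have infS z (t : R) : 0 <= t -> inf (S z) <= g (z + t *: y) - t * g y.
    by move=> t0; apply: ge_inf => //; exists t.
  have := gmin (fun z => inf (S z)) _ _ _ x.
  move=> /(_ _ _ _)/le_trans H.
  (* Minimality gives [g x <= inf (S x)], and the parameter [t = 1] bounds this infimum by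
     [g (x + y) - g y]. *)
  rewrite -lerBrDr; have := infS x 1 ler01; rewrite scale1r mul1r; apply: H.
  - move=> a b u v a0 b0 ab; apply: le_conv_inf => // _ _ [t /= t0 <-] [s /= s0 <-].
    (* The infimum over [t] of a jointly convex expression is convex: [a * t + b * s] is the
       parameter for the combined point. *)
    have ts0 : 0 <= a * t + b * s by rewrite addr_ge0// mulr_ge0.
    apply: (le_trans (infS _ _ ts0)).
    rewrite scalerDl -!scalerA addrACA -!scalerDr.
    have := cg a b (u + t *: y) (v + s *: y) a0 b0 ab; lra.
  - rewrite (_ : S 0 = [set 0]) ?inf1//; apply/seteqP; split=> [_ [t /= t0 <-]|_ ->].
      by rewrite add0r hom0// subrr.
    by exists 0 => //=; rewrite scale0r addr0 g0 mul0r subrr.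
  - by move=> z; have := infS z 0 (lexx 0); rewrite scale0r addr0 mul0r subr0.
have add x y : g (x + y) = g x + g y by apply/le_anti; rewrite subadd superadd.
have opp x : g (- x) = - g x.
  by apply/eqP; rewrite -addr_eq0 -add addrC subrr g0.
move=> a x y; rewrite add; congr (_ + _).
have [a0|a0] := leP 0 a; first exact: hom0.
by rewrite -[a]opprK scaleNr opp hom ?oppr_gt0// -mulNr.
Qed.

Lemma convex_linear_minorant h : convex h -> h 0 = 0 ->
  exists2 g : V -> R^o, linear g & forall x, g x <= h x.
Proof.
move=> ch h0; have [g [cg g0 gh gmin]] := minimal_convex ch h0.
by exists g => //; exact: minimal_convex_linear.
Qed.

End hahn_banach.

(** * Subgradients, weak limits and lower bounds on balls *)

Lemma subgradient_exists {R : realType} {X : normedModType R} (f : X -> R) (x0 : X) :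
  continuous f -> convex f ->
  exists phi : dual X, forall x, f x0 + phi (x - x0) <= f x.
Proof.
move=> fcont fconv; pose h v := f (x0 + v) - f x0.
have h0 : h 0 = 0 by rewrite /h addr0 subrr.
have hconv : convex h.
  move=> a b x y a0 b0 ab; have := fconv a b (x0 + x) (x0 + y) a0 b0 ab.
  rewrite !scalerDr addrACA -scalerDl ab scale1r /h !mulrBr.
  have -> : b = 1 - a by rewrite -ab addrC addKr.
  lra.
have [g glin gh] := convex_linear_minorant hconv h0.
pose G : {linear X -> R^o} := HB.pack g (GRing.isLinear.Build R X R^o *:%R g glin).
have gN v : g (- v) = - g v by exact: (linearN G).
have hcont : h v @[v --> (0 : X)] --> (0 : R).
  rewrite -h0 /h; apply: cvgB; last exact: cvg_cst.
  apply: continuous_comp; last exact: fcont.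
  by apply: cvgD; [exact: cvg_cst|exact: cvg_id].
have gcont : continuous g.
  apply: (continuousfor0_continuous (f := G)).
  rewrite /prop_for /continuous_at linear0.
  (* Linearity turns [g <= h] into [- h (- v) <= g v <= h v]. Both bounds tend to 0, and continuity
     at 0 suffices for a linear map. *)
  apply: (@squeeze_cvgr _ _ _ _ (fun v => - h (- v)) h) => //.
    by apply: nearW => v; rewrite gh andbT lerNl -gN gh.
  rewrite -[X in _ --> X]oppr0; apply: cvgN.
  have oppc : - v @[v --> (0 : X)] --> (0 : X).
    by rewrite -[Z in _ --> Z]oppr0; apply: cvgN; exact: cvg_id.
  exact: cvg_comp oppc hcont.
have gdual : g \in dual_pred (X := X) by apply/asboolP.
by exists (Dual gdual) => x; rewrite addrC -lerBrDr /=; have := gh (x - x0);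
  rewrite /h (addrC x0) subrK.
Qed.

(** Compactness of [[-M, M]] gives a cluster point, and an ultrafilter converges to each of its
    cluster points. *)
Lemma ultrafilter_bounded_cvg {R : realType} {T : Type} (U : set_system T)
    {UU : UltraFilter U} (u : T -> R) (M : R) :
  (forall t, `|u t| <= M) -> cvg (u @ U).
Proof.
move=> uM; have [|l [_ ul]] := @segment_compact R (- M) M (u @ U) _.
  by apply: nearW => t; rewrite /= in_itv /= -ler_norml.
apply/cvg_ex; exists l => A lA.
have [//|UnA] := in_ultra_setVsetC (u @^-1` A) UU.
by have [y [/= nAy Ay]] := ul _ _ (UnA : (u @ U) (~` A)) lA.
Qed.

(** Along an ultrafilter every functional has a limit at once, without extracting subsequences. The
    limits form a functional on the dual bounded by [M], which reflexivity represents by a point. *)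
Lemma reflexive_ultrafilter_weak_cvg {R : realType} {X : normedModType R}
    {T : Type} (U : set_system T) {UU : UltraFilter U} (u : T -> X) (M : R) :
  reflexive_space X -> (forall t, `|u t| <= M) ->
  exists x : X, forall phi : dual X, phi (u t) @[t --> U] --> phi x.
Proof.
move=> Xrefl uM.
have M0 : 0 <= M by have [t _] := filter_ex (@filterT _ U _); exact: le_trans (uM t).
have phiu (phi : dual X) t : `|phi (u t)| <= dual_norm phi * M.
  by rewrite (le_trans (ler_dual_norm _ _))// ler_wpM2l// dual_norm_ge0.
have cvgu (phi : dual X) : cvg (phi (u t) @[t --> U]).
  exact: ultrafilter_bounded_cvg (phiu phi).
pose F (phi : dual X) : R^o := lim (phi (u t) @[t --> U]).
have Flin : linear F.
  move=> a phi psi; apply: cvg_lim => //.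
  by apply: cvgD; [apply: cvgZl_tmp|]; exact: cvgu.
pose L : {linear dual X -> R^o} := HB.pack F (GRing.isLinear.Build R _ R^o *:%R F Flin).
have Fdual : F \in dual_pred (X := dual X).
  apply/asboolP; split=> //; apply: (bounded_linear_continuous (f := L)).
  apply/linear_boundedP; near=> r => phi.
  have FM : `|F phi| <= dual_norm phi * M.
    rewrite /F -(cvg_lim _ (cvg_norm (cvgu phi)))//.
    apply: limr_le; first exact: is_cvg_norm (cvgu phi).
    by apply: nearW => t; exact: phiu.
  apply: (le_trans FM); rewrite mulrC ler_wpM2r// ?dual_norm_ge0//.
  by near: r; apply: nbhs_pinfty_ge; rewrite num_real.
have [x xF] := Xrefl (Dual Fdual); exists x => phi.
have -> : phi x = F phi by rewrite -[LHS]/(dual_eval x phi) xF.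
exact: cvgu.
Unshelve. all: by end_near. Qed.

Lemma reflexive_convex_ball_inf_gt0 {R : realType} {X : normedModType R}
    (f : X -> R) (r : R) :
  reflexive_space X -> continuous f -> convex f -> (forall x, 0 < f x) ->
  exists2 c, 0 < c & forall x, `|x| <= r -> c <= f x.
Proof.
move=> Xrefl fcont fconv f0; apply: contrapT => nc.
have ex n : exists x, `|x| <= r /\ f x < n.+1%:R^-1.
  apply: contrapT => nx; apply: nc; exists n.+1%:R^-1; first by rewrite invr_gt0.
  by move=> x xr; rewrite leNgt; apply/negP => fx; apply: nx; exists x.
have [u /all_and2[ur uf]] := choice ex.
have [U [UU ooU]] := ultraFilterLemma (F := \oo) _.
have [x ux] := reflexive_ultrafilter_weak_cvg Xrefl ur.
have [phi phix] := subgradient_exists x fcont fconv.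
(* Some [n] satisfies both [phi (u n) > phi x - f x / 2] and [f (u n) < f x / 2], which contradicts
   the subgradient inequality at [u n]. *)
have fx2 : 0 < f x / 2 by rewrite divr_gt0.
have /filter_ex[n [un nx]] : U ([set n | phi x - f x / 2 < phi (u n)] `&`
    [set n | n.+1%:R^-1 < f x / 2]).
  apply: filterI.
    by apply: (cvgr_gt _ (ux phi)); rewrite ltrBlDr ltrDl.
  apply: ooU; near=> n => /=; rewrite invf_plt ?posrE//.
  apply: (@lt_le_trans _ _ n%:R); last by rewrite ler_nat.
  by near: n; exact: nbhs_infty_gtr.
have phiB : phi (u n - x) = phi (u n) - phi x :> R by exact: linearB.
move: un (phix (u n)) (lt_trans (uf n) nx); rewrite phiB /=.
by move: (phi (u n) : R) (phi x : R) => p q; lra.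
Unshelve. all: by end_near. Qed.

(** * A convex majorant on the line and scalar inequalities *)

Lemma convex_nondecreasing_majorant {R : realType} (c : nat -> R) : exists k : R -> R,
  [/\ continuous k, convex (k : R^o -> R), {homo k : x y / x <= y},
      forall r, 0 <= k r & forall n r, n%:R <= r < n.+1%:R -> c n <= k r].
Proof.
(* The hinge [e n] vanishes up to [n - 1] and is at least [c n] from [n] on; [k] will be the locally
   finite sum of all hinges. *)
pose e n (r : R) : R := `|c n| * Num.max 0 (r - n%:R + 1).
have e_ge0 n r : 0 <= e n r by rewrite /e mulr_ge0// le_max lexx.
have e_cvx n : convex (e n : R^o -> R).
  apply: convexZ => //; apply: convex_max; first exact: convex_cst.
  move=> a b x y _ _ ab; rewrite -[a *: x]/(a * x) -[b *: y]/(b * y).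
  have -> : b = 1 - a by rewrite -ab addrC addKr.
  by rewrite le_eqVlt; apply/orP; left; apply/eqP; ring.
have e_homo n : {homo e n : x y / x <= y}.
  move=> x y xy; rewrite /e ler_wpM2l// ge_max !le_max lexx /=.
  by rewrite lerD2r lerD2r xy orbT.
have e_cont n : continuous (e n).
  move=> x; apply: cvgM; first exact: cvg_cst.
  apply: (@continuous_max R R^o (fun=> 0) (fun r => r - n%:R + 1)).
    exact: cvg_cst.
  by apply: cvgD; [apply: cvgD; [exact: cvg_id|]|]; exact: cvg_cst.
pose s N r := \sum_(0 <= n < N) e n r.
have s_stable N r : r < N%:R -> forall m, s (N.+1 + m)%N r = s N.+1 r.
  move=> rN m; rewrite /s (@big_cat_nat _ _ _ N.+1) ?leq_addr//=.
  rewrite [X in _ + X]big1_seq ?addr0// => n /andP[_].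
  rewrite mem_index_iota => /andP[Nn _]; rewrite /e.
  rewrite max_l ?mulr0//.
  have : N.+1%:R <= n%:R :> R by rewrite ler_nat.
  by rewrite -natr1; lra.
(* With [N = truncn r + 1] one has [r < N], also for negative [r], where the truncation is 0. Hinges
   of index above [N] vanish at [r], so [N + 1] terms give the full sum. *)
pose k r := s (Num.truncn r).+2 r.
have kE N r : r < N%:R -> k r = s N.+1 r.
  move=> rN; have rT := truncnS_gt r.
  by rewrite /k -(s_stable _ _ rT N) -(s_stable _ _ rN (Num.truncn r).+1) addSn addnC addSn.
exists k; split.
- move=> x; set N := (Num.truncn x).+1.
  have xN : x < N%:R by exact: truncnS_gt.
  rewrite /continuous_at (kE N)//.
  have sc : s N.+1 y @[y --> x] --> s N.+1 x.
    rewrite /s; elim: (N.+1) => [|n IH].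
      under eq_fun do rewrite big_nil; rewrite big_nil; exact: cvg_cst.
    under eq_fun do rewrite big_nat_recr//=; rewrite big_nat_recr//=.
    by apply: cvgD => //; exact: e_cont.
  apply: cvg_trans sc; apply: near_eq_cvg.
  near=> y; rewrite (kE N)//; near: y; exact: lt_nbhsl.
- move=> a b x y a0 b0 ab.
  set N := (Num.truncn (Num.max x y)).+1.
  have xyN : Num.max x y < N%:R by exact: truncnS_gt.
  have := xyN; rewrite gt_max => /andP[xN yN].
  have zN : a *: (x : R^o) + b *: (y : R^o) < N%:R.
    apply: le_lt_trans xyN; rewrite -[_ + _]/(a * x + b * y) -[leRHS]mul1r -ab mulrDl.
    by rewrite lerD// ler_wpM2l// le_max lexx ?orbT.
  by rewrite !(kE N)//; apply: convex_sum.
- move=> x y xy; have yN := truncnS_gt y.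
  rewrite (kE _ _ yN) (kE _ _ (le_lt_trans xy yN)) /s.
  by apply: ler_sum => n _; exact: e_homo.
- by move=> r; apply: sumr_ge0.
- move=> n r /andP[nr rn].
  rewrite (kE _ _ rn) /s big_nat_recr//= big_nat_recr//=.
  have cn : c n <= e n r.
    rewrite (le_trans (ler_norm _))// /e ler_peMr// le_max.
    by apply/orP; right; lra.
  rewrite (le_trans cn)// -addrA addrCA lerDl addr_ge0//.
  by apply: sumr_ge0.
Unshelve. all: by end_near. Qed.

Lemma convex_inv_comb {R : realType} (a b u v : R) : 0 <= a -> 0 <= b -> a + b = 1 ->
  0 < u -> 0 < v -> (a * u + b * v)^-1 <= a * u^-1 + b * v^-1.
Proof.
move=> a0 b0 ab u0 v0.
have bE : b = 1 - a by rewrite -ab addrC addKr.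
have w0 : 0 < a * u + b * v.
  have [az|an0] := eqVneq a 0; first by rewrite bE az subr0 mul0r add0r mul1r.
  by rewrite ltr_pwDl ?mulr_gt0 ?mulr_ge0// ?ltW// lt0r an0.
rewrite -[leLHS]mul1r ler_pdivrMr// -subr_ge0.
have -> : (a * u^-1 + b * v^-1) * (a * u + b * v) - 1
    = a * b * (u - v) ^+ 2 * (u^-1 * v^-1).
  by rewrite bE; field; rewrite ?gt_eqF.
apply: mulr_ge0; last by rewrite mulr_ge0 ?invr_ge0// ltW.
by apply: mulr_ge0; [exact: mulr_ge0|exact: sqr_ge0].
Qed.

(** From [s] to [t] the inverse loses [(t - s) / (s * t)], at most [(t - s) * k], and the half
    square gains at least that much. *)
Lemma inv_add_sqr_homo {R : realType} (s t k : R) : 0 < s -> s <= t -> s^-1 ^+ 2 <= k ->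
  s^-1 + 2^-1 * (s + k) ^+ 2 <= t^-1 + 2^-1 * (t + k) ^+ 2.
Proof.
move=> s0 st sk; have t0 : 0 < t by exact: lt_le_trans st.
have k0 : 0 <= k by apply: le_trans sk; exact: sqr_ge0.
have inv_diff : s^-1 - t^-1 <= (t - s) * k.
  have -> : s^-1 - t^-1 = (t - s) * (s^-1 * t^-1).
    by field; rewrite !gt_eqF.
  rewrite ler_wpM2l ?subr_ge0//; apply: le_trans sk.
  by rewrite expr2 ler_wpM2l ?invr_ge0 ?(ltW s0)// lef_pV2 ?posrE.
have sqr_diff : (t - s) * k <= 2^-1 * (t + k) ^+ 2 - 2^-1 * (s + k) ^+ 2.
  rewrite -subr_ge0.
  have -> : 2^-1 * (t + k) ^+ 2 - 2^-1 * (s + k) ^+ 2 - (t - s) * k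
      = 2^-1 * ((t - s) * (t + s)) by field.
  by apply: mulr_ge0; rewrite ?invr_ge0// mulr_ge0 ?subr_ge0 ?addr_ge0// ltW.
by lra.
Qed.

(** * Products and reciprocals of d.c. functions *)

Section delta_convex_theory.
Context {R : realType} {X : normedModType R}.
Implicit Types (f g h : X -> R) (x y : X).

Lemma delta_convexT f g h : continuous g -> convex g -> continuous h -> convex h ->
  (forall x, f x = g x - h x) -> delta_convex [set: X] f.
Proof.
move=> gc gv hc hv fE; exists g, h; split=> //.
- exact: continuous_subspaceT.
- exact/convex_functionTP.
- exact: continuous_subspaceT.
- exact/convex_functionTP.
Qed.

(** Since [g x + g (- x) >= 2 * g 0], the positive part of [g (- x) - 2 * g 0] is a convex
    correction. *)
Lemma convex_ge0_shift g : continuous g -> convex g -> exists w : X -> R,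
  [/\ continuous w, convex w, forall x, 0 <= w x & forall x, 0 <= g x + w x].
Proof.
move=> gc gv; pose w x := Num.max 0 (g (- x) + (- 2 * g 0)).
exists w; split => [x|||x].
- apply: (@continuous_max R X (fun=> 0) (fun x => g (- x) + (- 2 * g 0))).
    exact: cvg_cst.
  apply: cvgD; last exact: cvg_cst.
  have oppc : - y @[y --> x] --> - x by apply: cvgN; exact: cvg_id.
  exact: cvg_comp oppc (gc (- x)).
- apply: convex_max; first exact: convex_cst.
  by apply: convexD; [exact: convex_oppx|exact: convex_cst].
- by move=> x; rewrite le_max lexx.
- have : g (- x) + - 2 * g 0 <= w x by rewrite le_max lexx orbT.
  have := gv 2^-1 2^-1 x (- x); rewrite scalerN subrr => /(_ _ _ _)/[!invr_ge0].
  by lra.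
Qed.

(** Adding the same corrections to both parts makes them nonnegative, so that their squares are
    convex. *)
Lemma delta_convexT_ge0 f : delta_convex [set: X] f -> exists g h : X -> R,
  [/\ continuous g /\ continuous h, convex g /\ convex h,
      forall x, 0 <= g x, forall x, 0 <= h x & forall x, f x = g x - h x].
Proof.
move=> [g [h [gsc /convex_functionTP gv hsc /convex_functionTP hv fE]]].
have contT q : {within [set: X], continuous q} -> continuous (q : X -> R).
  by move=> /subspace_continuousP qc x; have := qc x I; rewrite withinET.
have [gc hc] := (contT _ gsc, contT _ hsc).
have [u [uc uv u0 gu]] := convex_ge0_shift gc gv.
have [w [wc wv w0 hw]] := convex_ge0_shift hc hv.
exists (fun x => g x + u x + w x), (fun x => h x + w x + u x); split.
- split=> x; apply: cvgD; [apply: cvgD; [exact: gc|exact: uc]|exact: wc|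
    apply: cvgD; [exact: hc|exact: wc]|exact: uc].
- by split; do 2! apply: convexD => //.
- by move=> x; rewrite addr_ge0.
- by move=> x; rewrite addr_ge0.
- by move=> x; rewrite fE//; ring.
Qed.

Lemma continuous_sqr f : continuous f -> continuous (fun x => f x ^+ 2).
Proof. by move=> fc x; apply: cvgM; exact: fc. Qed.

(** Polarization: in the difference of the two [H] terms the pure squares cancel, leaving
    [g1 g2 + h1 h2 - g1 h2 - h1 g2]. *)
Lemma delta_convexM f1 f2 : delta_convex [set: X] f1 -> delta_convex [set: X] f2 ->
  delta_convex [set: X] (fun x => f1 x * f2 x).
Proof.
move=> /delta_convexT_ge0[g1 [h1 [[g1c h1c] [g1v h1v] g10 h10 f1E]]].
move=> /delta_convexT_ge0[g2 [h2 [[g2c h2c] [g2v h2v] g20 h20 f2E]]].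
pose H (u1 v1 u2 v2 : X -> R) x := 2^-1 * ((u1 x + v1 x) ^+ 2 + (u2 x + v2 x) ^+ 2).
have Hc u1 v1 u2 v2 : continuous u1 -> continuous v1 -> continuous u2 ->
    continuous v2 -> continuous (H u1 v1 u2 v2).
  move=> u1c v1c u2c v2c x; apply: cvgM; first exact: cvg_cst.
  by apply: cvgD; apply: continuous_sqr => y; apply: cvgD;
    [exact: u1c|exact: v1c|exact: u2c|exact: v2c].
have Hv u1 v1 u2 v2 : convex u1 -> convex v1 -> convex u2 -> convex v2 ->
    (forall x, 0 <= u1 x) -> (forall x, 0 <= v1 x) ->
    (forall x, 0 <= u2 x) -> (forall x, 0 <= v2 x) -> convex (H u1 v1 u2 v2).
  move=> u1v v1v u2v v2v u10 v10 u20 v20; apply: convexZ; first by rewrite invr_ge0.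
  by apply: convexD; apply: convex_sqr; rewrite ?addr_ge0//; try exact: convexD;
    move=> x; rewrite addr_ge0.
apply: (delta_convexT (g := H g1 g2 h1 h2) (h := H g1 h2 h1 g2)).
- exact: Hc.
- exact: Hv.
- exact: Hc.
- exact: Hv.
- by move=> x; rewrite f1E f2E /H; field.
Qed.

Lemma convex_comp_norm (k : R -> R) : convex (k : R^o -> R) -> {homo k : x y / x <= y} ->
  convex (fun x : X => k `|x|).
Proof.
move=> kv kh a b x y a0 b0 ab; apply: le_trans (kv a b `|x| `|y| a0 b0 ab).
by apply: kh; rewrite (le_trans (ler_normD _ _))// !normrZ !ger0_norm.
Qed.

(* With [k] a convex nondecreasing majorant of [1 / f ^ 2] over balls,
   [1 / s + (s + k) ^ 2 / 2] is nondecreasing in [s] at the relevant points,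
   hence convexity survives the substitution [s := f x]. *)
Lemma delta_convex_inv f : continuous f -> convex f -> (forall x, 0 < f x) ->
  (forall r, exists2 c, 0 < c & forall x, `|x| <= r -> c <= f x) ->
  delta_convex [set: X] (fun x => (f x)^-1).
Proof.
move=> fc fv f0 finf.
(* The radius [n + 1] covers every [r] with [n <= r < n + 1], the range on which [k] dominates the
   [n]-th value. *)
have ex (n : nat) : exists c, 0 < c /\ forall x, `|x| <= n.+1%:R -> c <= f x.
  by have [c c0 cf] := finf n.+1%:R; exists c.
have [c /all_and2[c0 cf]] := choice ex.
have [k [kc kv kh k0 kmaj]] := convex_nondecreasing_majorant (fun n => (c n)^-1 ^+ 2).
have kf x r : `|x| <= r -> (f x)^-1 ^+ 2 <= k r.
  move=> xr; have r0 : 0 <= r by exact: le_trans xr.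
  have rn := truncn_itv r0; apply: le_trans (kmaj _ _ rn).
  rewrite lerXn2r ?nnegrE ?invr_ge0 ?(ltW (f0 x)) ?(ltW (c0 _))//.
  rewrite lef_pV2 ?posrE// cf// (le_trans xr)// ltW//.
  by case/andP: rn.
have kNv := convex_comp_norm kv kh.
pose B x := 2^-1 * (f x + k `|x|) ^+ 2.
have fkv : convex (fun x => f x + k `|x|) by exact: convexD.
have fk0 x : 0 <= f x + k `|x| by rewrite addr_ge0// ltW.
have Bv : convex B by apply: convexZ; [rewrite invr_ge0|exact: convex_sqr].
have Bc : continuous B.
  move=> x; apply: cvgM; first exact: cvg_cst.
  apply: continuous_sqr => y; apply: cvgD; first exact: fc.
  exact: cvg_comp (@norm_continuous _ X y) (kc `|y|).
apply: (delta_convexT (g := fun x => (f x)^-1 + B x) (h := B)) => //.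
- move=> x; apply: cvgD; last exact: Bc.
  by apply: cvgV; [rewrite gt_eqF|exact: fc].
- move=> a b x y a0 b0 ab; set z := a *: x + b *: y.
  pose S := a * f x + b * f y; pose r := a * `|x| + b * `|y|.
  have zr : `|z| <= r by rewrite (le_trans (ler_normD _ _))// !normrZ !ger0_norm.
  have krL : k r <= a * k `|x| + b * k `|y| by exact: kv.
  have fS : f z <= S by exact: fv.
  have S0 : 0 < S by exact: lt_le_trans fS.
  have sq (s u v : R) : 0 <= s -> 0 <= u -> u <= v ->
      2^-1 * (s + u) ^+ 2 <= 2^-1 * (s + v) ^+ 2.
    move=> s0 u0 uv; have v0 := le_trans u0 uv.
    by rewrite ler_wpM2l ?invr_ge0// lerXn2r ?nnegrE ?addr_ge0// lerD2l.
  (* Raise [k] at the norm of [z] to [k r], then [f z] to [S] by the monotonicity above, and finally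
     use convexity of the inverse and of the square separately. *)
  apply: (@le_trans _ _ ((f z)^-1 + 2^-1 * (f z + k r) ^+ 2)).
    by rewrite lerD2l; apply: sq; [exact: ltW|exact: k0|exact: kh].
  apply: (le_trans (inv_add_sqr_homo (f0 z) fS (kf _ _ zr))).
  have -> : a * ((f x)^-1 + B x) + b * ((f y)^-1 + B y)
      = (a * (f x)^-1 + b * (f y)^-1) + (a * B x + b * B y) by ring.
  apply: lerD; first exact: convex_inv_comb.
  apply: (le_trans (sq _ _ _ (ltW S0) (k0 r) krL)).
  have := sqr_convex_comb (f x + k `|x|) (f y + k `|y|) a0 b0 ab.
  rewrite /B /S; have -> : a * (f x + k `|x|) + b * (f y + k `|y|)
    = a * f x + b * f y + (a * k `|x| + b * k `|y|) by ring.
  lra.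
- by move=> x; rewrite addrK.
Qed.

(** A change of sign would produce a zero on a segment by the intermediate value theorem. *)
Lemma continuous_neq0_sign f : continuous f -> (forall x, f x != 0) ->
  (forall x, 0 < f x) \/ (forall x, f x < 0).
Proof.
move=> fc fn0.
have same_sign x y : f x < 0 -> ~ 0 < f y.
  move=> fx fy; pose g (t : R) := f (x + t *: (y - x)).
  have gc : {within `[0, 1], continuous g}.
    apply: continuous_subspaceT => t.
    have lc : x + s *: (y - x) @[s --> t] --> x + t *: (y - x).
      by apply: cvgD; [exact: cvg_cst|apply: cvgZr_tmp; exact: cvg_id].
    exact: cvg_comp lc (fc _).
  have g0 : g 0 = f x by rewrite /g scale0r addr0.
  have g1 : g 1 = f y by rewrite /g scale1r addrC subrK.
  have [|t _ gt] := @IVT R g 0 1 0 ler01 gc.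
    by rewrite g0 g1 ge_min le_max (ltW fx) (ltW fy) orbT.
  by have := fn0 (x + t *: (y - x)); rewrite -[f _]/(g t) gt eqxx.
have [fneg|fnneg] := pselect (exists x, f x < 0); [right|left] => x.
  have [z fz] := fneg; have := fn0 x; rewrite neq_lt => /orP[//|fx].
  by have := same_sign z x fz.
by have := fn0 x; rewrite neq_lt => /orP[fx|//]; case: fnneg; exists x.
Qed.

End delta_convex_theory.

Theorem mainTheorem4 (R : realType) (X : completeNormedModType R)
    (Xrefl : reflexive_space X) (f1 f2 : X -> R)
    (f1_cont : continuous f1) (f1_conv : convex_function [set: X] f1)
    (f2_cont : continuous f2) (f2_conv : convex_function [set: X] f2)
    (f2_neq0 : forall x : X, f2 x != 0) :
  delta_convex [set: X] (fun x => f1 x / f2 x).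
Proof.
move: f1_conv f2_conv => /convex_functionTP f1v /convex_functionTP f2v.
have cst_dc c : delta_convex [set: X] (fun=> c).
  apply: (delta_convexT (g := fun=> c) (h := fun=> 0)).
  - by move=> x; exact: cvg_cst.
  - exact: convex_cst.
  - by move=> x; exact: cvg_cst.
  - exact: convex_cst.
  - by move=> x; rewrite subr0.
apply: delta_convexM.
  apply: (delta_convexT (g := f1) (h := fun=> 0)) => //.
  - by move=> x; exact: cvg_cst.
  - exact: convex_cst.
  - by move=> x; rewrite subr0.
have [f2_gt0|f2_lt0] := continuous_neq0_sign f2_cont f2_neq0.
  apply: delta_convex_inv => // r.
  exact: reflexive_convex_ball_inf_gt0.
(* A negative [f2] is bounded above by 0, so its inverse is constant. *)
have f2E := convex_bounded_above_cst f2v (fun x => ltW (f2_lt0 x)).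
rewrite (_ : (fun x => (f2 x)^-1) = fun=> (f2 0)^-1) //.
by apply/funext => x; rewrite (f2E x 0).
Qed.
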